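(* Let $n\ge2$ and let $(X,F)$ be a symmetric $n$-ary band. For $x,y\in X$ put $B(x,y)=\ell_x(y)=F(x,\ldots,x,y)$, with $x$ repeated $n-1$ times. Then $$\ell_x\circ\ell_y=\ell_y\circ\ell_x=\ell_{\ell_x(y)}=\ell_{\ell_y(x)},\qquad x,y\in X.$$ In other words, the pair $(X,B)$ is a right normal band.
   Context: An operation $F\colon X^n\to X$ ($X$ nonempty) is associative if $F(x_1,\ldots,x_{i-1},F(x_i,\ldots,x_{i+n-1}),x_{i+n},\ldots,x_{2n-1})=F(x_1,\ldots,x_i,F(x_{i+1},\ldots,x_{i+n}),x_{i+n+1},\ldots,x_{2n-1})$ for all $x_1,\ldots,x_{2n-1}\in X$ and $1\le i\le n-1$. A symmetric $n$-ary band is a pair $(X,F)$ with $F$ associative, invariant under permutations of its arguments, and idempotent ($F(x,\ldots,x)=x$ for all $x$). A band is a semigroup $(X,G)$ with $G(x,x)=x$ for all $x$; it is right normal if $G(G(x,y),z)=G(G(y,x),z)$ for all $x,y,z\in X$. Each $\ell_x$ is regarded as a map $X\to X$. *)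

(* Defs.v *)
From mathcomp Require Import all_boot all_fingroup.
Set Implicit Arguments.
Unset Strict Implicit.
Unset Printing Implicit Defensive.

Section NaryOperations.
Variables (X : Type) (n : nat).
Implicit Types (F : {ffun 'I_n -> X} -> X) (x y : X).

(* F(u_0, .., u_{i-1}, F(u_i, .., u_{i+n-1}), u_{i+n}, .., u_{2n-2}), with
   0-based indices.  For i < n only the entries u_0, .., u_{2n-2} occur, so
   u : nat -> X stands for an arbitrary element of X^(2n-1). *)
Definition nested F (u : nat -> X) (i : nat) : X :=
  F [ffun j : 'I_n => if j < i then u j
                      else if j == i :> nat then F [ffun k : 'I_n => u (i + k)]
                      else u (j + n.-1)].

Definition nary_associative F : Prop :=
  forall (u : nat -> X) (i : nat), i.+1 < n -> nested F u i = nested F u i.+1.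

Definition nary_symmetric F : Prop :=
  forall (s : {perm 'I_n}) (u : {ffun 'I_n -> X}), F [ffun j => u (s j)] = F u.

Definition nary_idempotent F : Prop :=
  forall x, F [ffun=> x] = x.

Definition symmetric_nary_band F : Prop :=
  [/\ nary_associative F, nary_symmetric F & nary_idempotent F].

Definition ell F x : X -> X :=
  fun y => F [ffun j : 'I_n => if j < n.-1 then x else y].

End NaryOperations.

Section BinaryOperations.
Variable X : Type.
Implicit Type G : X -> X -> X.

Definition band G : Prop := associative G /\ (forall x, G x x = x).

Definition right_normal_band G : Prop :=
  band G /\ (forall x y z, G (G x y) z = G (G y x) z).

End BinaryOperations.

(* Main.v *)
Require Import Defs.
From mathcomp Require Import all_boot all_fingroup.

(** Associativity and symmetry together say that the map [ell F x] can be
    moved from the value of [F] onto any one of its arguments: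
    [F(x, .., x, F(v_0, .., v_m)) = F(v_0, .., F(x, .., x, v_j), .., v_m)]
    ([ell_F_arg]).  All the identities follow from this one.
    - Moving [ell x] onto the last argument of [ell y z = F(y, .., y, z)]
      shows that [ell x] and [ell y] commute.
    - Moving [ell x] onto a first argument of [ell x z = F(x, .., x, z)], where
      idempotency gives [ell x x = x], shows that [ell x] is an idempotent map.
    - Since [ell x] is idempotent, it can be applied as often as desired, hence
      moved onto each of the first arguments of [ell y z = F(y, .., y, z)].
      This gives [ell x (ell y z) = F(ell x y, .., ell x y, z)], that is,
      [ell x \o ell y =1 ell (ell x y)].
    The last identity is the associativity of the binary operation, and together
    with commutation it gives right normality. *)

Section TranslationMaps.
Variables (X : Type) (m : nat) (F : {ffun 'I_m.+1 -> X} -> X).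

Lemma nested0 (u : nat -> X) i :
  nary_associative F -> i <= m -> nested F u 0 = nested F u i.
Proof.
by move=> FA; elim: i => // i IHi lt_i_m; rewrite IHi 1?ltnW // FA.
Qed.

(** This is associativity for the word [x, .., x, v_0, .., v_m], bracketed at
    its last and at its first possible position. *)
Lemma ell_F_head x (v : {ffun 'I_m.+1 -> X}) : nary_associative F ->
  ell F x (F v) = F [ffun i => if i == ord0 then ell F x (v i) else v i].
Proof.
move=> FA.
pose u k := if k < m then x else v (inord (k - m)).
have um (k : 'I_m.+1) : u (m + k) = v k.
  by rewrite /u ltnNge leq_addr /= addKn inord_val.
have -> : ell F x (F v) = nested F u m.
  congr (F _); apply/ffunP=> j; rewrite !ffunE /u /=.
  case: ltnP => // le_m_j.
  have -> : j == m :> nat by rewrite eqn_leq le_m_j -ltnS ltn_ord.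
  by congr (F _); apply/ffunP=> k; rewrite ffunE -[LHS]um.
rewrite -nested0 //; congr (F _); apply/ffunP=> j; rewrite !ffunE /=.
case: (eqVneq j ord0) => [->|nz_j]; last first.
  by rewrite -val_eqE /= in nz_j; rewrite (negPf nz_j) addnC um.
congr (F _); apply/ffunP=> k; rewrite !ffunE add0n /u.
case: ltnP => // le_m_k; congr (v _); apply: val_inj.
have -> : k - m = 0 by apply/eqP; rewrite subn_eq0 -ltnS.
by rewrite /= inordK.
Qed.

(** Conjugating by the transposition of positions [0] and [j] carries the
    previous identity from the first argument to the [j]-th. *)
Lemma ell_F_arg x (v : {ffun 'I_m.+1 -> X}) (j : 'I_m.+1) :
  nary_associative F -> nary_symmetric F ->
  ell F x (F v) = F [ffun i => if i == j then ell F x (v i) else v i].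
Proof.
move=> FA FS; rewrite -(FS (tperm ord0 j) v) ell_F_head //.
rewrite -(FS (tperm ord0 j)); congr (F _); apply/ffunP=> i.
by rewrite !ffunE tpermK (can2_eq (tpermK _ _) (tpermK _ _)) tpermL.
Qed.

(** The successive copies of [ell x] are moved onto successive arguments, one
    copy to each. *)
Lemma iter_ell_F x (v : {ffun 'I_m.+1 -> X}) k :
  nary_associative F -> nary_symmetric F -> k <= m ->
  iter k (ell F x) (F v) =
    F [ffun i : 'I_m.+1 => if i < k then ell F x (v i) else v i].
Proof.
move=> FA FS; elim: k => [_|k IHk lt_k_m] /=.
  by congr (F _); apply/ffunP=> i; rewrite ffunE.
rewrite IHk 1?ltnW // (ell_F_arg _ _ (inord k)) //; congr (F _).
apply/ffunP=> i; rewrite !ffunE -val_eqE /=.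
rewrite inordK ?(ltnS i k); last exact: leqW.
by case: ltngtP.
Qed.

Lemma ell_id x : nary_idempotent F -> ell F x x = x.
Proof.
move=> FI; rewrite -[RHS]FI.
by congr (F _); apply/ffunP=> i; rewrite !ffunE if_same.
Qed.

(** In [F(y, .., y, z)], moving [ell x] onto the last argument leaves the other
    arguments unchanged, so the result is again a value of [ell y]. *)
Lemma ell_comm x y z : nary_associative F -> nary_symmetric F ->
  ell F x (ell F y z) = ell F y (ell F x z).
Proof.
move=> FA FS; rewrite [ell F y z]/ell (ell_F_arg _ _ ord_max) //.
congr (F _); apply/ffunP=> i; rewrite !ffunE -val_eqE /=.
by have := ltn_ord i; rewrite ltnS; case: ltngtP.
Qed.

(** For [0 < m] the first argument of [F(x, .., x, z)] is [x], a fixed point of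
    [ell x]: moving [ell x] onto it changes nothing. *)
Lemma ell_idem x z : 0 < m -> symmetric_nary_band F ->
  ell F x (ell F x z) = ell F x z.
Proof.
move=> m_gt0 [FA _ FI]; rewrite {2}/ell ell_F_head //.
congr (F _); apply/ffunP=> i; rewrite !ffunE.
by case: eqP => // ->; rewrite m_gt0 ell_id.
Qed.

(** By idempotence [ell x] is its own [m]-th iterate, which is what it takes to
    turn each of the [m] arguments [y] of [F(y, .., y, z)] into [ell x y]. *)
Lemma ell_ell x y z : 0 < m -> symmetric_nary_band F ->
  ell F (ell F x y) z = ell F x (ell F y z).
Proof.
move=> m_gt0 FB; have [FA FS _] := FB.
have iter_ell k w : 0 < k -> iter k (ell F x) w = ell F x w.
  by case: k => // k _; elim: k => //= k ->; rewrite ell_idem.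
rewrite -[RHS](iter_ell m) // [ell F y z]/ell iter_ell_F //.
by congr (F _); apply/ffunP=> i; rewrite !ffunE /=; case: ltnP.
Qed.

End TranslationMaps.

Theorem proposition3p4 (X : Type) (hX : inhabited X) (n : nat) (hn : 2 <= n)
    (F : {ffun 'I_n -> X} -> X) (hF : symmetric_nary_band F) :
  let B : X -> X -> X := fun x y => ell F x y in
  (forall x y : X,
     [/\ ell F x \o ell F y =1 ell F y \o ell F x,
         ell F y \o ell F x =1 ell F (ell F x y)
       & ell F (ell F x y) =1 ell F (ell F y x)])
  /\ right_normal_band B.
Proof.
case: n hn F hF => // m m_gt0 F FB; have [FA FS FI] := FB; rewrite /=.
have comm x y z := @ell_comm _ _ F x y z FA FS.
have comp x y z := @ell_ell _ _ F x y z m_gt0 FB.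
have swap x y z : ell F (ell F x y) z = ell F (ell F y x) z.
  by rewrite !comp comm.
split=> [x y|]; first by split=> z //=; rewrite ?comp comm.
by split=> //; split=> [x y z | x]; rewrite ?comp ?ell_id.
Qed.
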